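(* Let $2\le k\le n$ and let $\Omega\subset\mathbb{R}^n$ be a $C^1$ bounded domain with outer unit normal $\nu$ on $\partial\Omega$. Let $\alpha_l\in C^0(\overline\Omega)$, $l=0,1,\dots,k-1$, be positive functions on $\overline\Omega$, let $\varphi\in C^0(\partial\Omega)$, and let $\varepsilon\in(0,1)$. Suppose $u\in C^2(\Omega)\cap C^1(\overline\Omega)$ is a $k$-admissible solution of $$ \begin{cases} \sigma_k(D^2u)=\sum_{l=0}^{k-1}\alpha_l(x)\,\sigma_l(D^2u) & \text{in }\Omega,\\ u_\nu=-\varepsilon u+\varphi(x) & \text{on }\partial\Omega. \end{cases} $$ Then $$\sup_\Omega|\varepsilon u|\le M_0,$$ where $M_0$ is a constant depending only on $n$, $k$, $\mathrm{diam}(\Omega)$, $\max_{\partial\Omega}|\varphi|$ and $\sum_{l=0}^{k-1}\sup_\Omega\alpha_l$ (in particular not on $\varepsilon$ or $u$).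
   Context: For $\lambda\in\mathbb{R}^n$ and $1\le m\le n$, $\sigma_m(\lambda)=\sum_{1\le i_1<\cdots<i_m\le n}\lambda_{i_1}\cdots\lambda_{i_m}$, and $\sigma_0=1$. For a $C^2$ function $u$, $\sigma_m(D^2u)=\sigma_m(\lambda(D^2u))$ where $\lambda(D^2u)=(\lambda_1,\dots,\lambda_n)$ are the eigenvalues of the Hessian matrix $D^2u$. The Gårding cone is $\Gamma_k=\{\lambda\in\mathbb{R}^n:\sigma_i(\lambda)>0,\ \forall\,1\le i\le k\}$. A function $u$ is $k$-admissible if $\lambda(D^2u(x))\in\Gamma_k$ for every $x\in\Omega$. $u_\nu$ denotes the derivative of $u$ in direction $\nu$. *)

(* Defs.v *)
From HB Require Import structures.
From mathcomp Require Import all_boot all_order all_algebra.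
From mathcomp Require Import all_classical all_reals all_analysis.
Set Implicit Arguments.
Unset Strict Implicit.
Unset Printing Implicit Defensive.
Import Order.TTheory GRing.Theory Num.Theory.
Import numFieldNormedType.Exports.
Local Open Scope classical_set_scope.
Local Open Scope ring_scope.

(* Points of R^n are row vectors.  Their library norm is the sup norm, which
   gives the usual topology and the usual bounded sets; every metric quantity
   below (unit vectors, diameter) uses the Euclidean norm [enorm]. *)

Definition dotv (R : realType) (n : nat) (u v : 'rV[R]_n) : R :=
  \sum_(i < n) u 0 i * v 0 i.

Definition enorm (R : realType) (n : nat) (v : 'rV[R]_n) : R :=
  Num.sqrt (dotv v v).

Definition diam (R : realType) (n : nat) (A : set 'rV[R]_n) : R :=
  sup [set enorm (p.1 - p.2) | p in A `*` A].

Definition frontier (R : realType) (n : nat) (A : set 'rV[R]_n) :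
    set 'rV[R]_n :=
  closure A `\` interior A.

Definition basis_vec (R : realType) (n : nat) (i : 'I_n) : 'rV[R]_n :=
  delta_mx 0 i.

Definition partial (R : realType) (n : nat) (i : 'I_n) (f : 'rV[R]_n -> R) :
    'rV[R]_n -> R :=
  fun x => 'D_(basis_vec R i) f x.

Definition grad (R : realType) (n : nat) (f : 'rV[R]_n -> R) (x : 'rV[R]_n) :
    'rV[R]_n :=
  \row_(i < n) partial i f x.

Definition hessian (R : realType) (n : nat) (f : 'rV[R]_n -> R)
    (x : 'rV[R]_n) : 'M[R]_n :=
  \matrix_(i < n, j < n) partial i (partial j f) x.

(* C^1 and C^2, meant for an open set A. *)
Definition C1_on (R : realType) (n : nat) (A : set 'rV[R]_n)
    (f : 'rV[R]_n -> R) : Prop :=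
  forall x, A x -> forall i : 'I_n,
    derivable f x (basis_vec R i) /\ {for x, continuous (partial i f)}.

Definition C2_on (R : realType) (n : nat) (A : set 'rV[R]_n)
    (f : 'rV[R]_n -> R) : Prop :=
  C1_on A f /\ forall i : 'I_n, C1_on A (partial i f).

(* C^1(closure A), for A open: f and its gradient on A extend continuously to
   the closure.  The values of f on the frontier are those of the extension. *)
Definition C1_closure (R : realType) (n : nat) (A : set 'rV[R]_n)
    (f : 'rV[R]_n -> R) : Prop :=
  [/\ C1_on A f, {within closure A, continuous f} &
      exists2 G : 'rV[R]_n -> 'rV[R]_n,
        {within closure A, continuous G} & forall x, A x -> G x = grad f x].

(* The value at x, in the closure of A, of the continuous extension of the
   gradient of f from A; this limit exists for f in [C1_closure A]. *)
Definition grad_closure (R : realType) (n : nat) (A : set 'rV[R]_n)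
    (f : 'rV[R]_n -> R) (x : 'rV[R]_n) : 'rV[R]_n :=
  lim (grad f y @[y --> within A (nbhs x)]).

Definition dir_deriv (R : realType) (n : nat) (A : set 'rV[R]_n)
    (f : 'rV[R]_n -> R) (v x : 'rV[R]_n) : R :=
  dotv (grad_closure A f x) v.

Definition domain (R : realType) (n : nat) (A : set 'rV[R]_n) : Prop :=
  [/\ open A, connected A & A !=set0].

(* rho is a C^1 defining function of A in the open neighbourhood U of x. *)
Definition C1_defining (R : realType) (n : nat) (A : set 'rV[R]_n)
    (x : 'rV[R]_n) (U : set 'rV[R]_n) (rho : 'rV[R]_n -> R) : Prop :=
  [/\ open U, U x, C1_on U rho &
      forall y, U y ->
        [/\ grad rho y != 0, A y <-> rho y < 0 & frontier A y <-> rho y = 0]].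

Definition C1_boundary (R : realType) (n : nat) (A : set 'rV[R]_n) : Prop :=
  forall x, frontier A x -> exists U rho, C1_defining A x U rho.

(* The outer unit normal is the normalized gradient of a defining function,
   which does not depend on the defining function. *)
Definition outer_unit_normal (R : realType) (n : nat) (A : set 'rV[R]_n)
    (x v : 'rV[R]_n) : Prop :=
  exists U rho, C1_defining A x U rho /\
    v = (enorm (grad rho x))^-1 *: grad rho x.

Definition sigma (R : realType) (n m : nat) (lam : 'rV[R]_n) : R :=
  \sum_(I : {set 'I_n} | #|I| == m) \prod_(i in I) lam 0 i.

(* The eigenvalues of A with multiplicity, in some order.  They exist whenever
   A is symmetric; the order is irrelevant to [sigma]. *)
Definition eigenvals (R : realType) (n : nat) (A : 'M[R]_n) : 'rV[R]_n :=
  xget 0 [set lam : 'rV[R]_n |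
    char_poly A = \prod_(i < n) ('X - (lam 0 i)%:P)].

Definition sigma_mx (R : realType) (n m : nat) (A : 'M[R]_n) : R :=
  sigma m (eigenvals A).

Definition garding_cone (R : realType) (n k : nat) : set 'rV[R]_n :=
  [set lam | forall i, (1 <= i <= k)%N -> 0 < sigma i lam].

Definition admissible (R : realType) (n k : nat) (A : set 'rV[R]_n)
    (f : 'rV[R]_n -> R) : Prop :=
  forall x, A x -> garding_cone k (eigenvals (hessian f x)).

(* Main.v *)
Require Import Defs.
From HB Require Import structures.
From mathcomp Require Import all_boot all_order all_algebra.
From mathcomp Require Import all_classical all_reals all_analysis.
From mathcomp Require Import ring lra.
Set Implicit Arguments.
Unset Strict Implicit.
Unset Printing Implicit Defensive.
Import Order.TTheory GRing.Theory Num.Theory.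
Import numFieldNormedType.Exports.
Local Open Scope classical_set_scope.
Local Open Scope ring_scope.

(** The bound is a maximum principle with a quadratic barrier.  Fix a point p
of the domain and consider the functions s * u - a * |x - p|^2 on the compact
closure of the domain.  At an interior minimum every eigenvalue l of the
Hessian of u satisfies s * l >= 2 * a ([hessian_eigen_min]).  At a minimum z on
the boundary, comparison with the points of the inner normal through z gives
s * u_nu <= 2 * a * <z - p, nu> ([dir_deriv_min]), and <z - p, nu> is controlled
by the diameter.  Once interior minima are excluded, the minimum is at such a
point z ([neumann_minimum]).  There the boundary condition u_nu = - eps * u + phi
turns the second inequality into a one-sided bound for eps * u, and minimality
carries this bound to the whole domain.

For the upper bound take s = -1 and a = 0: at an interior minimum of - u all
eigenvalues would be nonpositive, whereas admissibility contains sigma_1 > 0.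

For the lower bound take s = 1 and 2 * a = c := 1 + 2^n * S, where S is the sum
of the suprema of the coefficients.  At an interior minimum all eigenvalues
would be at least c >= 1, and then c * sigma_l <= 2^n * sigma_k for every l < k
([sigma_dominated]).  Multiplying by the coefficients and summing, the equation
gives c * sigma_k <= 2^n * S * sigma_k, which is absurd as sigma_k > 0 and
c > 2^n * S.  Because eps < 1 and c depends on n and S only, the resulting
constant is independent of eps and u. *)

(** * Directional derivatives of C^1 functions *)

Lemma is_derive_line (R : realType) (V : normedModType R) (f : V -> R) x v t d :
  is_derive (t *: v + x) v f d <-> is_derive t 1 (fun s => f (s *: v + x)) d.
Proof.
pose q1 (h : R) :=
  h^-1 *: ((f \o shift (t *: v + x)) (h *: v) - f (t *: v + x)).
pose q2 (h : R) := h^-1 *: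
  (((fun s => f (s *: v + x)) \o shift t) (h *: 1) - f (t *: v + x)).
have E : q1 = q2.
  by apply/funext => h; rewrite /q1 /q2 /= addrA -scalerDl [h%:A]mulr1.
split=> -[dv ev]; split.
- by change (cvg (q2 @ 0^')); rewrite -E; exact: dv.
- by change (lim (q2 @ 0^') = d); rewrite -E; exact: ev.
- by change (cvg (q1 @ 0^')); rewrite E; exact: dv.
- by change (lim (q1 @ 0^') = d); rewrite E; exact: ev.
Qed.

Lemma is_derive_scale (R : realType) (V : normedModType R) (f : V -> R) x v c
    d :
  is_derive x v f d -> is_derive x (c *: v) f (c * d).
Proof.
move=> fx.
have fx0 : is_derive (0 *: v + x) v f d by rewrite scale0r add0r.
suff : is_derive (0 *: (c *: v) + x) (c *: v) f (c * d).
  by rewrite scale0r add0r.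
apply/is_derive_line.
move/is_derive_line : fx0 => fx0.
have -> : (fun s : R => f (s *: (c *: v) + x)) =
    (fun s => f (s *: v + x)) \o ( *%R^~ c).
  by apply/funext => s /=; rewrite scalerA.
rewrite mulrC.
have H : is_derive (0 * c) 1 (fun s => f (s *: v + x)) d by rewrite mul0r.
have H2 : is_derive (0 : R) 1 ( *%R^~ c) c.
  have -> : ( *%R^~ c) = (id : R -> R) * cst c by apply/funext.
  apply: is_derive_eq; by rewrite /= scaler0 add0r [_ *: _]mulr1.
exact: is_derive1_comp.
Qed.

(** The increment along w + v splits into an increment along w from x and an
increment along v from a nearby point; by the mean value theorem the latter is
a derivative along v near x.  Continuity is therefore asked of one of the two
directional derivatives only, which allows adding directions one at a time. *)
Lemma is_derive_addv (R : realType) (V : normedModType R) (f : V -> R) x v w d :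
  (\forall y \near x, derivable f y v) ->
  {for x, continuous (fun y => 'D_v f y)} ->
  is_derive x w f d -> is_derive x (w + v) f (d + 'D_v f x).
Proof.
move=> dfv cfv [dw <-].
suff H : h^-1 *: ((f \o shift x) (h *: (w + v)) - f x) @[h --> (0 : R)^'] -->
    'D_w f x + 'D_v f x.
  by split; [apply/cvg_ex; eexists; exact: H | exact/cvg_lim].
have -> : (fun h : R => h^-1 *: ((f \o shift x) (h *: (w + v)) - f x)) =
  (fun h : R => h^-1 *: ((f \o shift x) (h *: w) - f x) +
      h^-1 *: (f (h *: v + (h *: w + x)) - f (h *: w + x))).
  apply/funext => h /=; rewrite -scalerDr; congr (_ *: _).
  have -> : h *: (w + v) + x = h *: v + (h *: w + x).
    by rewrite scalerDr addrA [h *: v + _]addrC.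
  by rewrite [RHS]addrC [RHS]addrA subrK.
apply: cvgD; first exact: dw.
apply/cvgrPdist_lt => e e0.
have /nbhs_ballP[r /= r0 Hr] : \forall y \near x,
    derivable f y v /\ `|'D_v f x - 'D_v f y| < e.
  by near=> y; split; near: y => //; move/cvgrPdist_lt : cfv; exact.
(* For |h| < r / K the segment from x + h *: w to x + h *: (w + v) stays in the
   ball of radius r; the added 1 keeps K positive when v = w = 0. *)
pose K := `|v| + `|w| + 1.
have K0 : 0 < K by rewrite /K ltr_wpDl// addr_ge0.
near=> h.
have hn : `|h| < r / K by near: h; apply: dnbhs0_lt; rewrite divr_gt0.
have h0 : h != 0 by near: h; exact: nbhs_dnbhs_neq.
have inb s : 0 <= s <= 1 -> ball x r (s *: (h *: v) + (h *: w + x)).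
  move=> /andP[s0 s1].
  rewrite -ball_normE /= addrA opprD addrCA subrr addr0 normrN.
  apply: (le_lt_trans (ler_normD _ _)); rewrite !normrZ (ger0_norm s0).
  rewrite ltr_pdivlMr// in hn; apply: le_lt_trans hn; rewrite /K.
  have := normr_ge0 v; have := normr_ge0 w; have := normr_ge0 h => h1 w1 v1.
  have : s * (`|h| * `|v|) <= `|h| * `|v| by rewrite ler_piMl// mulr_ge0.
  by rewrite !mulrDr; lra.
have [s||c cI E] := @MVT R (fun s => f (s *: (h *: v) + (h *: w + x)))
   (fun s => h * 'D_v f (s *: (h *: v) + (h *: w + x))) 0 1 ltr01.
- rewrite in_itv/= => /andP[/ltW s0 /ltW s1].
  have s01 : 0 <= s <= 1 by rewrite s0 s1.
  have [D _] := Hr _ (inb _ s01).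
  exact: (proj1 (is_derive_line _ _ _ _ _) (is_derive_scale h (derivableP D))).
- apply: derivable_within_continuous => s; rewrite in_itv/= => s01.
  have [D _] := Hr _ (inb _ s01).
  have := proj1 (is_derive_line _ _ _ _ _) (is_derive_scale h (derivableP D)).
  by case.
move: E; rewrite scale1r scale0r add0r subr0 mulr1 => ->.
rewrite [_ *: _]mulrA mulVf// mul1r.
have [|_] := Hr _ (inb c _); last by [].
by move: cI; rewrite in_itv/= => /andP[/ltW-> /ltW->].
Unshelve. all: by end_near. Qed.

Lemma dotvC (R : realType) n (u v : 'rV[R]_n) : dotv u v = dotv v u.
Proof. by apply: eq_bigr => i _; rewrite mulrC. Qed.

Lemma dotvDl (R : realType) n (u v w : 'rV[R]_n) :
  dotv (u + v) w = dotv u w + dotv v w.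
Proof. by rewrite -big_split; apply: eq_bigr => i _; rewrite mxE mulrDl. Qed.

Lemma dotvZl (R : realType) n c (u v : 'rV[R]_n) :
  dotv (c *: u) v = c * dotv u v.
Proof. by rewrite mulr_sumr; apply: eq_bigr => i _; rewrite mxE mulrA. Qed.

Lemma dotv_ge0 (R : realType) n (u : 'rV[R]_n) : 0 <= dotv u u.
Proof. by apply: sumr_ge0 => i _; rewrite -expr2 sqr_ge0. Qed.

Lemma dotv_gt0 (R : realType) n (u : 'rV[R]_n) : u != 0 -> 0 < dotv u u.
Proof.
move=> u0; rewrite lt_def dotv_ge0 andbT; apply: contra_neq u0 => uu.
apply/rowP => i; rewrite mxE; apply/eqP.
have /(_ uu) : dotv u u = 0 -> forall j, u 0 j * u 0 j = 0.
  by move=> /psumr_eq0P H j; apply: H => // k _; rewrite -expr2 sqr_ge0.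
by move=> /(_ i)/eqP; rewrite mulf_eq0 orbb.
Qed.

Lemma dotv_lineE (R : realType) n (w z : 'rV[R]_n) t :
  dotv (t *: w + z) (t *: w + z) =
  dotv w w * t ^+ 2 + 2 * dotv z w * t + dotv z z.
Proof.
rewrite dotvDl dotvZl 2![dotv _ (_ + _)]dotvC !dotvDl !dotvZl [dotv w z]dotvC.
by ring.
Qed.

Lemma is_derive_dotv_line (R : realType) n (w z : 'rV[R]_n) (t : R) :
  is_derive t (1 : R) (fun t => dotv (t *: w + z) (t *: w + z))
    (2 * dotv (t *: w + z) w).
Proof.
pose P := (dotv w w)%:P * 'X^2 + (2 * dotv z w)%:P * 'X + (dotv z z)%:P.
have -> : (fun t => dotv (t *: w + z) (t *: w + z)) = horner P.
  by apply/funext => s; rewrite dotv_lineE /P !hornerE.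
have -> : 2 * dotv (t *: w + z) w = P^`().[t].
  by rewrite dotvDl dotvZl /P !poly.derivE !hornerE; ring.
exact: is_derive_poly.
Qed.

Lemma is_derive_dotv_linear (R : realType) n (w z : 'rV[R]_n) (t : R) :
  is_derive t (1 : R) (fun t => dotv (t *: w + z) w) (dotv w w).
Proof.
pose P := (dotv w w)%:P * 'X + (dotv z w)%:P.
have -> : (fun t => dotv (t *: w + z) w) = horner P.
  by apply/funext => s; rewrite dotvDl dotvZl /P !hornerE mulrC.
have -> : dotv w w = P^`().[t].
  by rewrite /P !poly.derivE !hornerE; ring.
exact: is_derive_poly.
Qed.

Lemma dotv_cvg (R : realType) n (T : Type) (F : set_system T)
    (G H : T -> 'rV[R]_n) (a b : 'rV[R]_n) : Filter F ->
  G x @[x --> F] --> a -> H x @[x --> F] --> b ->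
  dotv (G x) (H x) @[x --> F] --> dotv a b.
Proof.
move=> FF Ga Hb; rewrite /dotv.
elim: (index_enum _) => [|i s IH].
  rewrite big_nil; under eq_fun do rewrite big_nil; exact: cvg_cst.
rewrite big_cons; under eq_fun do rewrite big_cons.
apply: cvgD => //; apply: cvgM.
- exact: (cvg_comp _ _ Ga (@coord_continuous _ _ _ _ _ a)).
- exact: (cvg_comp _ _ Hb (@coord_continuous _ _ _ _ _ b)).
Qed.

(** Continuous partial derivatives give all directional derivatives: the
coordinate components of v are added one after the other. *)
Lemma C1_is_derive (R : realType) n (A : set 'rV[R]_n) f x v :
  open A -> C1_on A f -> A x -> is_derive x v f (dotv (grad f x) v).
Proof.
move=> oA cf Ax.
rewrite {1}(row_sum_delta v) /dotv.
elim: (index_enum _) => [|i s IH]; first by rewrite !big_nil; exact: is_derive0.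
rewrite !big_cons [X in is_derive _ X]addrC [grad f x 0 i * _ + _]addrC.
have [dfi cfi] := cf _ Ax i.
have nA : \forall y \near x, A y by exact: open_nbhs_nbhs.
have Dy y : A y ->
    is_derive y (v 0 i *: basis_vec R i) f (v 0 i * partial i f y).
  by move=> Ay; apply: is_derive_scale; apply: derivableP; have [] := cf _ Ay i.
rewrite -/(basis_vec R i).
have -> : grad f x 0 i * v 0 i = 'D_(v 0 i *: basis_vec R i) f x.
  by rewrite (@derive_val _ _ _ _ _ _ _ (Dy _ Ax)) mxE mulrC.
apply: is_derive_addv.
  by near=> y; have Ay : A y by [near: y; exact: nA]; have [] := Dy y Ay.
have DE y : A y -> 'D_(v 0 i *: basis_vec R i) f y = v 0 i * partial i f y.
  by move=> /Dy[].
change ('D_(v 0 i *: basis_vec R i) f y @[y --> x] -->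
  'D_(v 0 i *: basis_vec R i) f x).
rewrite (DE x Ax).
have H : v 0 i * partial i f y @[y --> x] --> v 0 i * partial i f x.
  exact: cvgM (cvg_cst (v 0 i)) cfi.
apply: cvg_trans H.
have N : \forall y \near x,
    v 0 i * partial i f y = 'D_(v 0 i *: basis_vec R i) f y.
  by near=> y; rewrite DE//; near: y; exact: nA.
exact: (near_eq_cvg N).
Unshelve. all: by end_near. Qed.

Lemma C1_is_derive_line (R : realType) n (A : set 'rV[R]_n) f x w t :
  open A -> C1_on A f -> A (t *: w + x) ->
  is_derive t 1 (fun s : R => f (s *: w + x)) (dotv (grad f (t *: w + x)) w).
Proof.
move=> oA cf Ax.
exact: (proj1 (is_derive_line _ _ _ _ _) (C1_is_derive w oA cf Ax)).
Qed.

Lemma C2_is_derive_line (R : realType) n (A : set 'rV[R]_n) f x w t :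
  open A -> C2_on A f -> A (t *: w + x) ->
  is_derive t 1 (fun s : R => dotv (grad f (s *: w + x)) w)
    (dotv (w *m hessian f (t *: w + x)) w).
Proof.
move=> oA [_ cf] Ax.
have -> : (fun s : R => dotv (grad f (s *: w + x)) w) =
   \sum_(i < n) (fun s : R => w 0 i * partial i f (s *: w + x)).
  apply/funext => s; rewrite fct_sumE.
  by apply: eq_bigr => i _; rewrite mxE mulrC.
have -> : dotv (w *m hessian f (t *: w + x)) w =
    \sum_(i < n) w 0 i * dotv (grad (partial i f) (t *: w + x)) w.
  apply: eq_bigr => i _; rewrite mxE mulrC; congr (_ * _).
  by apply: eq_bigr => j _; rewrite !mxE mulrC.
apply: is_derive_sum => i.
have := C1_is_derive_line oA (cf i) Ax.
by move=> H; have := is_deriveZ (w 0 i) H.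
Qed.

Lemma is_deriveBZ (R : realType) (f g : R -> R) (t a b df dg : R) :
  is_derive t (1 : R) f df -> is_derive t (1 : R) g dg ->
  is_derive t (1 : R) (fun s => a * f s - b * g s) (a * df - b * dg).
Proof.
move=> Df Dg; exact: (is_deriveB (is_deriveZ a Df) (is_deriveZ b Dg)).
Qed.

Lemma is_derive_tilted_line (R : realType) n (A : set 'rV[R]_n) f x
    (p w : 'rV[R]_n) (s a t : R) :
  open A -> C1_on A f -> A (t *: w + x) ->
  is_derive t (1 : R)
    (fun r => s * f (r *: w + x) - a * dotv (r *: w + x - p) (r *: w + x - p))
    (s * dotv (grad f (t *: w + x)) w - a * (2 * dotv (t *: w + x - p) w)).
Proof.
move=> oA cf Ax; apply: is_deriveBZ; first exact: C1_is_derive_line oA cf Ax.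
rewrite -addrA.
have -> : (fun r : R => dotv (r *: w + x - p) (r *: w + x - p)) =
  (fun r => dotv (r *: w + (x - p)) (r *: w + (x - p))).
  by apply/funext => r; rewrite !addrA.
exact: is_derive_dotv_line.
Qed.

Lemma line_continuous (R : realType) n (w x : 'rV[R]_n) :
  continuous (fun t : R => t *: w + x).
Proof.
move=> t; apply: cvgD; last exact: cvg_cst.
exact: cvgZr_tmp.
Qed.

Lemma open_line_near (R : realType) n (A : set 'rV[R]_n) (w x : 'rV[R]_n) :
  open A -> A x -> exists2 d : R, 0 < d & forall t, `|t| < d -> A (t *: w + x).
Proof.
move=> oA Ax.
have nA : nbhs (0 *: w + x) A.
  by rewrite scale0r add0r; exact: open_nbhs_nbhs.
have /nbhs_ballP[d /= d0 Hd] := @line_continuous R n w x 0 A nA.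
by exists d => // t td; apply: Hd; rewrite -ball_normE /= sub0r normrN.
Qed.

(** * One-variable minimum tests *)

(** A derivative negative just to the right of 0 would make g decrease there, by
the mean value theorem on [0, t]. *)
Lemma right_min_derive_not_neg (R : realType) (g h : R -> R) (d : R) : 0 < d ->
  (forall t : R, 0 < t < d -> is_derive t (1 : R) g (h t)) ->
  g t @[t --> 0^'+] --> g 0 -> (forall t : R, 0 < t < d -> g 0 <= g t) ->
  ~ \forall t \near 0^'+, h t < 0.
Proof.
move=> d0 dg g0 gmin [r /= r0 Hr].
pose t := Num.min r d / 2.
have m0 : 0 < Num.min r d by rewrite lt_min r0.
have [tr td] : t < r /\ t < d.
  have : t < Num.min r d by rewrite /t; lra.
  by rewrite lt_min => /andP.
have t0 : 0 < t by rewrite divr_gt0.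
have cg s : 0 < s < d -> {for s, continuous g}.
  move=> sd; apply: differentiable_continuous; apply/derivable1_diffP.
  by have [] := dg s sd.
have [s|| s sI E2] := @MVT R g h 0 t t0.
- rewrite in_itv/= => /andP[s0 st]; apply: dg.
  by rewrite s0 (lt_trans st).
- apply/continuous_within_itvP => //; split=> [s||].
  + by rewrite in_itv/= => /andP[s0 st]; apply: cg; rewrite s0 (lt_trans st).
  + exact: g0.
  + by apply: cvg_at_left_filter; apply: cg; rewrite t0 td.
have := gmin t; rewrite t0 td => /(_ isT).
apply/negP; rewrite -ltNge -subr_lt0 E2 subr0 nmulr_rlt0//.
move: sI; rewrite in_itv/= => /andP[s0 st].
apply: Hr => //=.
by rewrite sub0r normrN gtr0_norm// (lt_trans st).
Qed.

Lemma first_order_min_right (R : realType) (g h : R -> R) (c d : R) : 0 < d ->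
  (forall t : R, 0 < t < d -> is_derive t (1 : R) g (h t)) ->
  g t @[t --> 0^'+] --> g 0 -> h t @[t --> 0^'+] --> c ->
  (forall t : R, 0 < t < d -> g 0 <= g t) -> 0 <= c.
Proof.
move=> d0 dg g0 hc gmin; rewrite leNgt; apply/negP => c0.
exact: (right_min_derive_not_neg d0 dg g0 gmin (cvgr_lt _ hc _ c0)).
Qed.

Lemma derive_lt0_near_right (R : realType) (f : R -> R) (c : R) :
  is_derive (0 : R) (1 : R) f c -> f 0 = 0 -> c < 0 ->
  \forall t \near 0^'+, f t < 0.
Proof.
move=> [df fc] f0 c0.
have E : (fun t => t^-1 *: ((f \o shift 0) (t *: (1 : R)) - f 0)) =
    (fun t => t^-1 * f t).
  by apply/funext => t; rewrite /= addr0 f0 subr0 [t%:A]mulr1.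
have H : t^-1 * f t @[t --> (0 : R)^'] --> c.
  by move: df fc; rewrite /derivable /derive E => df <-.
have [r /= r0 Hr] := cvgr_lt _ H _ c0.
exists r => //= t tr t0.
by rewrite -(pmulr_rlt0 (x := t^-1)) ?invr_gt0//; apply: Hr; rewrite ?gt_eqF.
Qed.

(** The first derivative h vanishes at the interior minimum 0, so c < 0 would
make h negative just to the right of 0. *)
Lemma second_order_min (R : realType) (g h : R -> R) (c d : R) : 0 < d ->
  (forall t : R, `|t| < d -> is_derive t (1 : R) g (h t)) ->
  is_derive (0 : R) (1 : R) h c ->
  (forall t, `|t| < d -> g 0 <= g t) -> 0 <= c.
Proof.
move=> d0 dg dh gmin; rewrite leNgt; apply/negP => c0.
have inI t : t \in `](- d), d[ -> `|t| < d by rewrite in_itv/= ltr_norml.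
have z : (0 : R) \in `](- d), d[ by rewrite in_itv/= oppr_lt0 d0.
have pos t : 0 < t < d -> `|t| < d by move=> /andP[t0 td]; rewrite gtr0_norm.
have h0 : h 0 = 0.
  have E : is_derive (0 : R) 1 g 0.
    apply: (@derive1_at_min _ g (- d) d) => //.
    - by rewrite ge0_cp// ltW.
    - by move=> t /inI/dg[].
    - by move=> t /inI/gmin.
  by have [_ <-] := dg 0 (inI _ z); have [_ ->] := E.
apply: (@right_min_derive_not_neg _ g h d) => //.
- by move=> t /pos/dg.
- apply: cvg_at_right_filter; apply: differentiable_continuous.
  by apply/derivable1_diffP; have [] := dg 0 (inI _ z).
- by move=> t /pos/gmin.
- exact: derive_lt0_near_right dh h0 c0.
Qed.

(** * Minima of a function tilted by a paraboloid *)

(** Along the line through x in the direction of an eigenvector w, the second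
derivative of the tilted function is (s * l - 2 * a) * |w|^2. *)
Lemma hessian_eigen_min (R : realType) n (A : set 'rV[R]_n) f x
    (p w : 'rV[R]_n) (s a l : R) :
  open A -> C2_on A f -> A x ->
  (forall y, A y -> s * f x - a * dotv (x - p) (x - p) <=
                    s * f y - a * dotv (y - p) (y - p)) ->
  w *m hessian f x = l *: w -> w != 0 -> 2 * a <= s * l.
Proof.
move=> oA cf Ax xmin wl w0.
have [d d0 Hd] := open_line_near w oA Ax.
pose h (t : R) :=
  s * dotv (grad f (t *: w + x)) w - a * (2 * dotv (t *: w + x - p) w).
have x0 : 0 *: w + x = x by rewrite scale0r add0r.
have /= D1 : forall t : R, `|t| < d -> is_derive t (1 : R) _ (h t) :=
  fun t td => is_derive_tilted_line p s a oA cf.1 (Hd t td).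
have D2 : is_derive (0 : R) (1 : R) h (s * dotv (l *: w) w - a * 2 * dotv w w).
  have -> : h = fun t => s * dotv (grad f (t *: w + x)) w -
      (a * 2) * dotv (t *: w + (x - p)) w.
    by apply/funext => t; rewrite /h -addrA mulrA.
  apply: is_deriveBZ; last exact: is_derive_dotv_linear.
  rewrite -wl -{2}x0.
  by apply: C2_is_derive_line oA cf _; rewrite x0.
have := second_order_min d0 D1 D2.
rewrite x0 => H.
have : 0 <= s * dotv (l *: w) w - a * 2 * dotv w w.
  by apply: H => t td; apply: xmin; exact: Hd.
have := dotv_gt0 w0; rewrite dotvZl => ww.
by rewrite mulrA -mulrBl pmulr_lge0// subr_ge0 mulrC.
Qed.

(** The derivative of rho at x along - grad rho x is - |grad rho x|^2 < 0, so
rho becomes negative at once along this ray. *)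
Lemma outward_normal_points_in (R : realType) n (A U : set 'rV[R]_n) rho x :
  C1_defining A x U rho -> frontier A x ->
  exists2 d : R, 0 < d & forall t, 0 < t < d -> A (t *: - grad rho x + x).
Proof.
move=> [oU Ux crho HU] Fx; set w := - grad rho x.
have [d d0 Hd] := open_line_near w oU Ux.
have rx0 : rho x = 0 by have [_ _ /iffLR] := HU x Ux; apply.
have x0 : 0 *: w + x = x by rewrite scale0r add0r.
have D := @C1_is_derive_line _ _ U rho x w 0 oU crho.
rewrite x0 in D; have {}D := D Ux.
have c0 : dotv (grad rho x) w < 0.
  rewrite dotvC /w -scaleN1r dotvZl mulN1r oppr_lt0; apply: dotv_gt0.
  by have [] := HU x Ux.
have [|r /= r0 Hr] := derive_lt0_near_right D _ c0; first by rewrite x0.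
exists (Num.min r d) => [|t /andP[t0]]; first by rewrite lt_min r0.
rewrite lt_min => /andP[tr td].
have Ut : U (t *: w + x) by apply: Hd; rewrite gtr0_norm.
have [_ /iffRL HA _] := HU _ Ut; apply: HA.
by apply: Hr => //=; rewrite sub0r normrN gtr0_norm.
Qed.

Lemma grad_closure_cvg (R : realType) n (A : set 'rV[R]_n) f x :
  C1_closure A f -> closure A x ->
  grad f y @[y --> within A (nbhs x)] --> grad_closure A f x.
Proof.
move=> [_ _ [G cG GE]] clx.
have PF : ProperFilter (within A (nbhs x)) by exact: within_nbhs_proper.
have H : grad f y @[y --> within A (nbhs x)] --> G x.
  apply: (@cvg_trans _ (G y @[y --> within A (nbhs x)])).
    by apply: fmap_within_eq => y /set_mem Ay; rewrite GE.
  move/subspace_continuousP : cG => /(_ x clx).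
  apply: cvg_trans; apply: cvg_app; apply: within_subset; exact: subset_closure.
by rewrite /grad_closure (cvg_lim _ H)//; exact: norm_hausdorff.
Qed.

(** The tilted function is at least its value at x along the inner normal ray,
and differentiable on this ray away from x.  Its derivatives on the ray
converge, as the ray approaches x, to the pairing of the extended gradient with
the inner normal, and this limit must be nonnegative. *)
Lemma dir_deriv_min (R : realType) n (A : set 'rV[R]_n) f
    (x p v : 'rV[R]_n) (s a : R) :
  open A -> C1_closure A f -> outer_unit_normal A x v -> frontier A x ->
  (forall y, A y -> s * f x - a * dotv (x - p) (x - p) <=
                    s * f y - a * dotv (y - p) (y - p)) ->
  s * dir_deriv A f v x <= a * (2 * dotv (x - p) v).
Proof.
move=> oA cf [U [rho [drho vE]]] Fx xmin.
have [d d0 Hd] := outward_normal_points_in drho Fx.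
move: Hd; set w := - grad rho x => Hd.
have clx : closure A x by case: Fx.
have [cf1 cf0 _] := cf.
have x0 : 0 *: w + x = x by rewrite scale0r add0r.
have lw : (fun t : R => t *: w + x) @ 0^'+ --> x.
  by apply: cvg_at_right_filter; rewrite -{2}x0; exact: line_continuous.
have lA : (fun t : R => t *: w + x) @ 0^'+ --> within A (nbhs x).
  move=> B /lw; rewrite /= /nbhs /= => HB.
  near=> t.
  have : A (t *: w + x).
    apply: Hd; apply/andP; split; near: t; first exact: nbhs_right_gt.
    exact: nbhs_right_lt.
  near: t; exact: HB.
have lz : (fun t : R => t *: w + x - p) @ 0^'+ --> x - p.
  by apply: cvgB => //; exact: cvg_cst.
have D := fun (t : R) (td : 0 < t < d) =>
  is_derive_tilted_line p s a oA cf1 (Hd t td).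
pose c := s * dotv (grad_closure A f x) w - a * (2 * dotv (x - p) w).
have := first_order_min_right (c := c) d0 D; rewrite x0 => K.
(* As v is the vector - w scaled by the inverse length of grad rho x, the
   claim is 0 <= c up to that positive factor. *)
suff : 0 <= c.
  rewrite /c /dir_deriv vE ![dotv _ (_ *: _)]dotvC !dotvZl /w -scaleN1r.
  rewrite ![dotv _ (_ *: _)]dotvC !dotvZl.
  set b := (enorm _)^-1; set X := dotv _ (grad_closure _ _ _).
  set Y := dotv _ (x - p).
  move=> H.
  have b0 : 0 <= b by rewrite invr_ge0 sqrtr_ge0.
  rewrite -subr_ge0.
  have -> : a * (2 * (b * Y)) - s * (b * X) =
      b * (s * (-1 * X) - a * (2 * (-1 * Y))) by ring.
  by rewrite mulr_ge0.
apply: K.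
- apply: cvgB; apply: cvgMl_tmp; last exact: dotv_cvg.
  move/subspace_continuousP : cf0 => /(_ x clx) H.
  apply: (cvg_comp _ _ lA); apply: cvg_trans H; apply: cvg_app.
  by apply: within_subset; exact: subset_closure.
- apply: cvgB; apply: cvgMl_tmp.
    apply: dotv_cvg; last exact: cvg_cst.
    exact: (cvg_comp _ _ lA (grad_closure_cvg cf clx)).
  by apply: cvgMl_tmp; apply: dotv_cvg => //; exact: cvg_cst.
- by move=> t td; apply: xmin; exact: Hd.
Unshelve. all: by end_near. Qed.

(** * Elementary symmetric functions of the eigenvalues *)

Lemma prodr_ge1 (R : realType) (I : finType) (P : pred I) (F : I -> R) :
  (forall i, P i -> 1 <= F i) -> 1 <= \prod_(i | P i) F i.
Proof. by move=> F1; elim/big_rec: _ => // i x /F1; exact: mulr_ege1. Qed.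

Lemma sigma1_le0 (R : realType) n (lam : 'rV[R]_n) :
  (forall i, lam 0 i <= 0) -> sigma 1 lam <= 0.
Proof.
by move=> lam0; apply: sumr_le0 => I /cards1P[i ->]; rewrite big_set1.
Qed.

(** If the characteristic polynomial did not split, [eigenvals] would take its
default value 0, which is outside the cone: its sigma_1 vanishes. *)
Lemma eigenvals_eigenvalue (R : realType) n k (A : 'M[R]_n) i : (0 < k)%N ->
  garding_cone k (eigenvals A) -> eigenvalue A (eigenvals A 0 i).
Proof.
move=> k0; rewrite /eigenvals; case: xgetP => [lam _ charA _|_ cone].
  rewrite eigenvalue_root_char charA /root horner_prod.
  by apply/prodf_eq0; exists i => //; rewrite hornerXsubC subrr.
have := cone 1; rewrite k0 => /(_ isT).
by rewrite ltNge sigma1_le0// => j; rewrite mxE.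
Qed.

Lemma extend_set n k (J : {set 'I_n}) : (#|J| <= k <= n)%N ->
  exists2 I : {set 'I_n}, #|I| = k & J \subset I.
Proof.
move=> /andP[Jk kn].
have /card_geqP[s [us ss sJ]] : (k - #|J| <= #|~: J|)%N.
  by rewrite -(leq_add2l #|J|) cardsC card_ord subnKC.
exists (J :|: [set x in s]); last exact: finset.subsetUl.
rewrite cardsU; have -> : J :&: [set x in s] = finset.set0.
  apply/setP => x; rewrite !inE; apply/negP => /andP[xJ /sJ].
  by rewrite inE xJ.
by rewrite cards0 subn0 cardsE (card_uniqP us) ss subnKC.
Qed.

(** A set J of l < k indices extends to a set I of k indices, at the cost of at
least one factor that is at least c and of others that are at least 1.  Hence c
times the monomial of J is at most the monomial of I, which is at most sigma_k;
there are at most 2^n sets J. *)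
Lemma sigma_dominated (R : realType) n (l k : nat) (c : R) (lam : 'rV[R]_n) :
  1 <= c -> (forall i, c <= lam 0 i) -> (l < k <= n)%N ->
  c * sigma l lam <= 2 ^+ n * sigma k lam.
Proof.
move=> c1 clam /andP[lk kn].
have lam1 i : 1 <= lam 0 i by exact: le_trans (clam i).
have lam0 i : 0 <= lam 0 i by exact: le_trans (lam1 i).
have term (I : {set 'I_n}) : #|I| = k -> \prod_(i in I) lam 0 i <= sigma k lam.
  move=> Ik; rewrite /sigma (bigD1 I) /= ?Ik// lerDl.
  by apply: sumr_ge0 => ? _; exact: prodr_ge0.
have sk0 : 0 <= sigma k lam by apply: sumr_ge0 => ? _; exact: prodr_ge0.
rewrite /sigma mulr_sumr -/(sigma k lam).
apply: (@le_trans _ _ (\sum_(J : {set 'I_n} | #|J| == l) sigma k lam)).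
  apply: ler_sum => J /eqP Jl.
  have [|I Ik JI] := @extend_set n k J; first by rewrite Jl (ltnW lk).
  have /set0Pn[i] : I :\: J != finset.set0.
    by rewrite -card_gt0 cardsD (finset.setIidPr JI) Jl Ik subn_gt0.
  rewrite inE => /andP[iJ iI].
  apply: le_trans (term I Ik); rewrite [leRHS](big_setID J) /=.
  rewrite (finset.setIidPr JI) mulrC.
  apply: ler_wpM2l; first exact: prodr_ge0.
  rewrite (bigD1 i) /=; last by rewrite inE iJ.
  apply: le_trans (clam i) _; rewrite ler_peMr//.
  exact: prodr_ge1.
rewrite sumr_const -[leLHS]mulr_natl; apply: ler_wpM2r => //.
rewrite -natrX ler_nat; apply: leq_trans (max_card _) _.
by rewrite -[n in (2 ^ n)%N]card_ord -cardsT -powersetT card_powerset cardsT.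
Qed.

(** * Compactness and the diameter *)

Lemma compact_closure (R : realType) n (A : set 'rV[R]_n) :
  bounded_set A -> compact (closure A).
Proof.
move=> /pinfty_ex_gt0[M M0 AM].
apply: bounded_closed_compact; last exact: closed_closure.
exists M; split=> [|N MN x clx]; first exact: num_real.
suff : closed_ball_ Num.norm 0 M x.
  by rewrite /closed_ball_ /= sub0r normrN => /le_trans; apply; exact: ltW.
apply: (closed_closed_ball_ (x := 0) (e := M)).
apply: closureS clx => y Ay.
by rewrite /closed_ball_ /= sub0r normrN; exact: AM.
Qed.

Lemma closure_open (R : realType) n (A : set 'rV[R]_n) x :
  open A -> closure A x -> A x \/ frontier A x.
Proof.
move=> /interior_id iA clx; have [|nA] := pselect (A x); first by left.
by right; split=> //; rewrite iA.
Qed.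

Lemma compact_frontier (R : realType) n (A : set 'rV[R]_n) :
  compact (closure A) -> compact (frontier A).
Proof.
move=> cA; apply: (subclosed_compact _ cA); last by move=> x [].
apply: closedI; first exact: closed_closure.
exact/open_closedC/open_interior.
Qed.

(** In a realType the sup of an unbounded set is a default value, so it is
compactness that makes this sup an upper bound. *)
Lemma compact_le_sup (R : realType) (T : topologicalType) (K B : set T)
    (f : T -> R) x :
  compact K -> {within K, continuous f} -> B `<=` K -> B x ->
  f x <= sup [set f y | y in B].
Proof.
move=> cK cf BK Bx.
have [|z _ zmax] := compact_EVT_max _ cK cf; first by exists x; exact: BK.
apply: ub_le_sup; last by exists x.
by exists (f z) => _ [y By <-]; apply: zmax; apply: mem_set; exact: BK.
Qed.

Lemma enorm_le_diam (R : realType) n (A : set 'rV[R]_n) x y :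
  compact (closure A) -> A x -> A y -> enorm (x - y) <= diam A.
Proof.
move=> cA Ax Ay.
apply: (@compact_le_sup _ _ (closure A `*` closure A) (A `*` A)
  (fun q => enorm (q.1 - q.2)) (x, y)) => //.
- exact: compact_setX.
- apply: continuous_subspaceT => -[q1 q2].
  have H : (fun q : 'rV[R]_n * 'rV[R]_n => q.1 - q.2) @ nbhs (q1, q2) -->
      q1 - q2.
    apply: (@cvgB _ _ _ (nbhs (q1, q2)) _ fst snd); first exact: cvg_fst.
    exact: cvg_snd.
  have S := @sqrt_continuous R (dotv (q1 - q2) (q1 - q2)).
  exact: (cvg_comp _ _ (dotv_cvg (nbhs_filter (q1, q2)) H H) S).
- by move=> q [] q1 q2; split; exact: subset_closure.
Qed.

Lemma dotv_le_diam (R : realType) n (A : set 'rV[R]_n) x p :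
  compact (closure A) -> A p -> closure A x ->
  dotv (x - p) (x - p) <= diam A ^+ 2.
Proof.
move=> cA Ap clx.
have H y : A y -> dotv (y - p) (y - p) <= diam A ^+ 2.
  move=> Ay; rewrite -(sqr_sqrtr (dotv_ge0 (y - p))) -/(enorm (y - p)).
  rewrite lerXn2r ?nnegrE ?sqrtr_ge0 ?enorm_le_diam//.
  by rewrite (le_trans _ (enorm_le_diam cA Ap Ap))// sqrtr_ge0.
have PF : ProperFilter (within A (nbhs x)) by exact: within_nbhs_proper.
have L : y - p @[y --> within A (nbhs x)] --> x - p.
  by apply: cvgB; [exact: cvg_within | exact: cvg_cst].
apply: (cvgr_to_le (dotv_cvg _ L L)).
by rewrite near_withinE; near=> y; exact: H.
Unshelve. all: by end_near. Qed.

Lemma tilted_min_attained (R : realType) n (A : set 'rV[R]_n) f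
    (p : 'rV[R]_n) (s a : R) :
  compact (closure A) -> A !=set0 -> {within closure A, continuous f} ->
  exists2 x, closure A x & forall y, closure A y ->
    s * f x - a * dotv (x - p) (x - p) <= s * f y - a * dotv (y - p) (y - p).
Proof.
move=> cA [z Az] cf.
have [||x /set_mem Ax xmin] := @compact_EVT_min _ R
   (fun y => s * f y - a * dotv (y - p) (y - p)) _ _ cA.
- by exists z; exact: subset_closure.
- apply/subspace_continuousP => x clx.
  have L : y - p @[y --> within (closure A) (nbhs x)] --> x - p.
    by apply: cvgB; [exact: cvg_within | exact: cvg_cst].
  apply: cvgB; apply: cvgMl_tmp; last exact: dotv_cvg.
  by move/subspace_continuousP : cf => /(_ x clx).
- by exists x => // y Ay; apply: xmin; exact: mem_set.
Qed.

Lemma outer_unit_normal_unit (R : realType) n (A : set 'rV[R]_n) x v :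
  outer_unit_normal A x v -> dotv v v = 1.
Proof.
move=> [U [rho [[_ Ux _ HU] ->]]].
have [g0 _ _] := HU x Ux.
rewrite dotvZl dotvC dotvZl -[X in _ * (_ * X)](sqr_sqrtr (dotv_ge0 _)).
rewrite -/(enorm _) expr2 mulKf ?mulVf// gt_eqF// sqrtr_gt0; exact: dotv_gt0.
Qed.

Lemma dotv_unit_le (R : realType) n (z v : 'rV[R]_n) :
  dotv v v = 1 -> 2 * dotv z v <= dotv z z + 1.
Proof.
move=> vv; have := dotv_ge0 ((-1) *: v + z).
by rewrite dotv_lineE vv; lra.
Qed.

(** * The a priori estimate *)

(** The hypothesis on eigenvalues excludes interior minima of
s * f - a * |x - p|^2, so the minimum over the closure is attained at a boundary
point z, where the two conclusions are the normal derivative test and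
minimality.  The case s = -1 yields maxima of f. *)
Lemma neumann_minimum (R : realType) n (Omega : set 'rV[R]_n)
    (nu : 'rV[R]_n -> 'rV[R]_n) (f : 'rV[R]_n -> R) (p : 'rV[R]_n) (s a : R) :
  open Omega -> bounded_set Omega -> Omega p ->
  (forall x, frontier Omega x -> outer_unit_normal Omega x (nu x)) ->
  C2_on Omega f -> C1_closure Omega f -> 0 <= a ->
  (forall x, Omega x ->
     exists2 l, eigenvalue (hessian f x) l & s * l < 2 * a) ->
  exists2 z, frontier Omega z &
    s * dir_deriv Omega f (nu z) z <= a * (diam Omega ^+ 2 + 1) /\
    forall y, Omega y -> s * f z - a * diam Omega ^+ 2 <= s * f y.
Proof.
move=> oO bO Op nuP c2 c1 a0 nomin.
have cO := compact_closure bO.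
have [z clz zmin] : exists2 z, closure Omega z & forall y, closure Omega y ->
    s * f z - a * dotv (z - p) (z - p) <= s * f y - a * dotv (y - p) (y - p).
  by apply: tilted_min_attained => //; [exists p | case: c1].
have Omin y : Omega y ->
    s * f z - a * dotv (z - p) (z - p) <= s * f y - a * dotv (y - p) (y - p).
  by move=> Oy; apply: zmin; exact: subset_closure.
have dz := dotv_le_diam cO Op clz.
have [Oz|Fz] := closure_open oO clz.
  have [l /eigenvalueP[w wl w0]] := nomin z Oz.
  by rewrite ltNge (hessian_eigen_min oO c2 Oz Omin wl w0).
exists z => //; split.
  apply: le_trans (dir_deriv_min oO c1 (nuP z Fz) Fz Omin) _.
  apply: ler_wpM2l => //.
  have vv := outer_unit_normal_unit (nuP z Fz).
  by apply: le_trans (dotv_unit_le _ vv) _; rewrite lerD2r.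
move=> y Oy; have := Omin y Oy.
have := ler_wpM2l a0 dz; have := mulr_ge0 a0 (dotv_ge0 (y - p)); lra.
Qed.

Theorem theorem3p1 (R : realType) :
  exists M0 : nat -> nat -> R -> R -> R -> R,
  forall (n k : nat) (Omega : set 'rV[R]_n) (nu : 'rV[R]_n -> 'rV[R]_n)
    (alpha : 'I_k -> 'rV[R]_n -> R) (phi : 'rV[R]_n -> R) (eps : R)
    (u : 'rV[R]_n -> R),
  (2 <= k <= n)%N ->
  domain Omega -> bounded_set Omega -> C1_boundary Omega ->
  (forall x, frontier Omega x -> outer_unit_normal Omega x (nu x)) ->
  (forall l, {within closure Omega, continuous (alpha l)}) ->
  (forall l x, closure Omega x -> 0 < alpha l x) ->
  {within frontier Omega, continuous phi} ->
  0 < eps < 1 ->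
  C2_on Omega u -> C1_closure Omega u ->
  admissible k Omega u ->
  (forall x, Omega x ->
     sigma_mx k (hessian u x) =
     \sum_(l < k) alpha l x * sigma_mx l (hessian u x)) ->
  (forall x, frontier Omega x ->
     dir_deriv Omega u (nu x) x = - eps * u x + phi x) ->
  (ereal_sup [set `|eps * u x|%:E | x in Omega] <=
   (M0 n k (diam Omega)
      (sup [set `|phi x| | x in frontier Omega])
      (\sum_(l < k) sup [set alpha l x | x in Omega]))%:E)%E.
Proof.
(* With a = c / 2, the normal derivative test costs a * (d^2 + 1) and the
   oscillation of the barrier over the domain costs a * d^2. *)
exists (fun n k d P S => P + (1 + 2 ^+ n * S) / 2 * (d ^+ 2 + 1) +
  (1 + 2 ^+ n * S) / 2 * d ^+ 2).
move=> n k Omega nu alpha phi eps u /andP[k2 kn] [oO _ [p Op]] bO _ nuP calpha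
  alpha0 cphi /andP[eps0 eps1] c2 c1 adm eqn bc.
have k0 : (0 < k)%N by exact: ltnW.
have cO := compact_closure bO.
have cF := compact_frontier cO.
set d := diam Omega; set P := sup _; set S := \sum_(l < k) _.
have alphaS (l : 'I_k) x :
    Omega x -> alpha l x <= sup [set alpha l y | y in Omega].
  by move=> Ox; apply: compact_le_sup cO (calpha l) _ Ox; exact: subset_closure.
have salpha0 (l : 'I_k) : 0 <= sup [set alpha l y | y in Omega].
  apply: le_trans (alphaS l p Op); apply/ltW/alpha0; exact: subset_closure.
have S0 : 0 <= S by exact: sumr_ge0.
have phiP x : frontier Omega x -> `|phi x| <= P.
  move=> Fx; apply: (compact_le_sup (f := fun y => `|phi y|) cF _ _ Fx) => //.
  by move=> y; apply: cvg_norm; exact: cphi.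
pose c : R := 1 + 2 ^+ n * S.
have cge1 : 1 <= c by rewrite lerDl mulr_ge0// exprn_ge0.
rewrite -/c; set a := c / 2.
have a0 : 0 <= a by rewrite divr_ge0// (le_trans _ cge1).
have spec x i (Ox : Omega x) := eigenvals_eigenvalue i k0 (adm x Ox).
have d0 : 0 <= a * d ^+ 2 by rewrite mulr_ge0// sqr_ge0.
have d1 : 0 <= a * (d ^+ 2 + 1) by rewrite mulr_ge0// addr_ge0// sqr_ge0.
have lower y : Omega y -> - (P + a * (d ^+ 2 + 1) + a * d ^+ 2) <= eps * u y.
  move=> Oy.
  have [|z Fz [nz zmin]] := neumann_minimum (s := 1) oO bO Op nuP c2 c1 a0.
    move=> x Ox; set lam := eigenvals (hessian u x).
    suff [i il] : exists i, lam 0 i < c.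
      by exists (lam 0 i); [exact: spec | rewrite mul1r /a mulrC divfK].
    apply: contrapT => /forallNP clam.
    have {}clam i : c <= lam 0 i by rewrite leNgt; apply/negP.
    have sk : 0 < sigma k lam by apply: adm => //; rewrite k0 leqnn.
    have sl (l : 'I_k) : 0 <= sigma l lam.
      apply: sumr_ge0 => I _; apply: prodr_ge0 => i _.
      exact: le_trans (le_trans ler01 cge1) (clam i).
    have : c * sigma k lam <= 2 ^+ n * S * sigma k lam.
      have E : sigma k lam = \sum_(l < k) alpha l x * sigma l lam := eqn x Ox.
      rewrite [X in c * X <= _]E mulr_sumr mulrAC [leRHS]mulr_sumr.
      apply: ler_sum => l _.
      rewrite mulrCA [leRHS]mulrC; apply: ler_pM.
      - by apply/ltW/alpha0; exact: subset_closure.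
      - by rewrite mulr_ge0 ?sl// (le_trans ler01 cge1).
      - exact: alphaS.
      - by apply: sigma_dominated => //; rewrite ltn_ord.
    by rewrite ler_pM2r// /c; lra.
  have := zmin y Oy; rewrite !mul1r => zy.
  move: nz; rewrite mul1r bc// => nz.
  have := phiP z Fz; rewrite ler_norml => /andP[pz _].
  have : eps * (u z - a * d ^+ 2) <= eps * u y.
    by apply: ler_wpM2l => //; exact: ltW.
  have : eps * (a * d ^+ 2) <= a * d ^+ 2 by rewrite ler_piMl// ltW.
  move: nz; rewrite -/d; lra.
have upper y : Omega y -> eps * u y <= P.
  move=> Oy.
  have [|z Fz [nz zmin]] := neumann_minimum (s := -1) oO bO Op nuP c2 c1
    (lexx 0).
    move=> x Ox; set lam := eigenvals (hessian u x).
    suff [i il] : exists i, 0 < lam 0 i.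
      by exists (lam 0 i); [exact: spec | rewrite mulN1r mulr0 oppr_lt0].
    apply: contrapT => /forallNP lam0.
    have : 0 < sigma 1 lam by apply: adm.
    apply/negP; rewrite -leNgt; apply: sigma1_le0 => i.
    by rewrite leNgt; apply/negP.
  have := zmin y Oy; rewrite mul0r subr0 !mulN1r lerN2 => yz.
  move: nz; rewrite mul0r bc// => nz.
  have := phiP z Fz; rewrite ler_norml => /andP[_ pz].
  have : eps * u y <= eps * u z by apply: ler_wpM2l => //; exact: ltW.
  by lra.
apply: ge_ereal_sup => _ [x Ox <-].
rewrite lee_fin ler_norml lower//=.
by have := upper x Ox; lra.
Qed.
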